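(* Let $s:[1,\infty)\to\mathbb{C}$ be Lebesgue integrable on every bounded interval $(1,t)$, $t>1$, and let $$\tau(t):=\frac{1}{\log t}\int_1^t\frac{s(x)}{x}\,dx,\qquad t>1.$$ Suppose that $s$ is slowly oscillating with respect to summability $(L,1)$. If $\tau$ has statistical limit $\ell$ at $\infty$ for some number $\ell$, then the ordinary limit $\lim_{x\to\infty}s(x)$ exists and equals $\ell$.
   Context: The logarithm is to the natural base $e$, and $|\{\cdot\}|$ denotes Lebesgue measure. Statistical limit: a (real- or complex-valued) measurable function $g$ on an interval $(a,\infty)$, $a\ge 0$, has statistical limit $\ell$ (a finite number) at $\infty$ if for every $\varepsilon>0$, $$\lim_{b\to\infty}\frac{1}{b-a}\Big|\{x\in(a,b):|g(x)-\ell|>\varepsilon\}\Big|=0.$$ The choice of the left endpoint $a$ is immaterial; for $\tau$ one may take $a=1$. Slow oscillation: a function $s:[1,\infty)\to\mathbb{C}$ is slowly oscillating with respect to summability $(L,1)$ (logarithmic summability) if $$\lim_{\lambda\to1^+}\ \limsup_{x\to\infty}\ \sup_{x<t\le x^\lambda}|s(t)-s(x)|=0.$$ Equivalently: for every $\varepsilon>0$ there exist $x_0=x_0(\varepsilon)>1$ and $\lambda=\lambda(\varepsilon)>1$ such that $|s(t)-s(x)|\le\varepsilon$ whenever $x_0\le x<t\le x^\lambda$. *)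

(* Defs.v *)
From HB Require Import structures.
From mathcomp Require Import all_boot all_order all_algebra.
From mathcomp Require Import complex.
From mathcomp Require Import all_classical all_reals all_analysis.

Set Implicit Arguments.
Unset Strict Implicit.
Unset Printing Implicit Defensive.
Import Order.TTheory GRing.Theory Num.Theory.
Import numFieldNormedType.Exports.

Local Open Scope classical_set_scope.
Local Open Scope ring_scope.

(* In mathcomp-analysis, lebesgue_measure lives on the Borel sigma-algebra.   *)
(* Integrability is meant here for Lebesgue measurable functions, hence the   *)
(* use of the completed measure throughout. Functions on [1, +oo[ are total   *)
(* functions on R whose values to the left of 1 are irrelevant.               *)

Definition cintegrable (R : realType) (D : set R) (f : R -> R[i]) : Prop :=
  completed_lebesgue_measure.-integrable D (fun x => (complex.Re (f x))%:E) /\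
  completed_lebesgue_measure.-integrable D (fun x => (complex.Im (f x))%:E).

Definition cintegral (R : realType) (D : set R) (f : R -> R[i]) : R[i] :=
  Complex (Rintegral completed_lebesgue_measure D (fun x => complex.Re (f x)))
          (Rintegral completed_lebesgue_measure D (fun x => complex.Im (f x))).

Definition log_mean (R : realType) (s : R -> R[i]) (t : R) : R[i] :=
  ((ln t)%:C)%C^-1 * cintegral `]1, t[ (fun x => s x / (x%:C)%C).

(* completed_lebesgue_measure is defined on all sets, as Lebesgue outer       *)
(* measure; it is Lebesgue measure on the exceptional set of a measurable g.  *)
Definition statistical_limit (R : realType) (a : R) (g : R -> R[i]) (l : R[i])
    : Prop :=
  forall eps : R, 0 < eps ->
    (((b - a)^-1)%:E * completed_lebesgue_measure
       [set x : R | (a < x < b)%R /\ (eps < Normc.normc (g x - l)%R)%R])%E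
    @[b --> +oo%R] --> 0%E.

Definition slowly_oscillating_L1 (R : realType) (s : R -> R[i]) : Prop :=
  limf_esup
    (fun x : R => ereal_sup
       [set (Normc.normc (s t - s x))%:E | t in `]x, x `^ lambda]])
    (pinfty_nbhs R)
  @[lambda --> (1 : R)^'+] --> 0%E.

(* Main.v *)
Require Import Defs.
From HB Require Import structures.
From mathcomp Require Import all_boot all_order all_algebra.
From mathcomp Require Import complex.
From mathcomp Require Import all_classical all_reals all_analysis.
From mathcomp Require Import measurable_realfun.
From mathcomp Require Import ring lra.
Set Implicit Arguments.
Unset Strict Implicit.
Unset Printing Implicit Defensive.
Import Order.TTheory GRing.Theory Num.Theory.
Import numFieldNormedType.Exports.
Local Open Scope classical_set_scope.
Local Open Scope ring_scope.

(** The Tauberian condition is used once, on a single window to the right of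
    [x], and the statistical limit only through two well-placed points.

    Given [e > 0], slow oscillation provides [h > 0] such that, for [x] large,
    [s] stays within [e] of [s x] on the window from [x] to [x `^ (1 + h)]
    ([slowly_oscillating_near]). The points where the logarithmic mean [tau]
    is at distance more than [d] from [l] form a set of density zero, whereas
    for [1 <= p < q] the interval from [x `^ p] to [x `^ q] fills more than
    half of the interval from [1] to [x `^ q] when [x] is large; so that
    interval contains a point where [tau] is within [d] of [l]
    ([statistical_limit_near]). This gives such points
    [x < x1 < x `^ (1 + h / 3)] and
    [x `^ (1 + 2 * h / 3) < x2 < x `^ (1 + h)].

    The integral of [s y / y] from [x1] to [x2] is
    [ln x2 * tau x2 - ln x1 * tau x1], which differs from
    [l * (ln x2 - ln x1)] by at most [d * (ln x1 + ln x2)]. As [s] is within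
    [e] of [s x] between [x1] and [x2], the same integral differs from
    [s x * (ln x2 - ln x1)] by at most [e * (ln x2 - ln x1)]. Hence
    [`|s x - l| <= e + d * (ln x1 + ln x2) / (ln x2 - ln x1)]
    ([real_log_mean_oscillation], applied to the real and imaginary parts).
    The last quotient is at most [6 * (1 + h) / h], a bound that does not
    depend on [x], so [d] can be chosen to make the last term at most [e]
    ([log_gap_bound]). *)

Local Notation cleb := completed_lebesgue_measure.

(** * Borel functions and the completed Lebesgue measure *)

Lemma measurable_fun_id_completed (R : realType) :
  measurable_fun setT
    (id : caratheodory_type (wlength idfun)^*%mu -> measurableTypeR R).
Proof. by move=> _ A mA; rewrite setTI preimage_id; exact: sub_caratheodory. Qed.

Lemma measurable_fun_completed (R : realType) (D : set R) (f : R -> R) :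
  measurable D -> measurable_fun D f ->
  measurable_fun (D : set (caratheodory_type (wlength (@idfun R))^*%mu)) f.
Proof. by move=> mD mf _ A mA; apply: sub_caratheodory; exact: mf. Qed.

Lemma ge0_integral_completed (R : realType) (D : set R) (f : R -> R) :
  measurable D -> measurable_fun D f -> (forall x, D x -> 0 <= f x) ->
  (\int[cleb]_(x in D) (f x)%:E = \int[lebesgue_measure]_(x in D) (f x)%:E)%E.
Proof.
move=> mD mf f0; symmetry.
(* Lebesgue measure is the image of its completion under the identity. *)
rewrite (@eq_measure_integral _ _ _ _ (pushforward cleb id))//; last first.
have transfer := @ge0_integral_pushforward _ _ _ _ R _
  (@measurable_fun_id_completed R) cleb D _ mD
  (proj2 (measurable_EFinP _ _) mf).
by rewrite transfer// => x /set_mem Dx; rewrite lee_fin; exact: f0.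
Qed.

Lemma within_continuous_inv (R : realType) (D : set R) :
  (forall x, D x -> 0 < x) -> {within D, continuous (@GRing.inv R)}.
Proof.
move=> D0; apply: continuous_in_subspaceT => x /set_mem /D0 x0.
by apply: inv_continuous; rewrite gt_eqF.
Qed.

Lemma measurable_fun_inv_gt0 (R : realType) (D : set R) :
  measurable D -> (forall x, D x -> 0 < x) -> measurable_fun D (@GRing.inv R).
Proof.
move=> mD D0; apply: subspace_continuous_measurable_fun => //.
exact: within_continuous_inv.
Qed.

Lemma integral_inv_ln (R : realType) (a b : R) : 0 < a -> a < b ->
  (\int[cleb]_(x in `[a, b[) (x^-1)%:E = (ln b - ln a)%:E)%E.
Proof.
move=> a0 ab.
have pos x : a <= x -> 0 < x by apply: lt_le_trans.
have mi : measurable_fun `[a, b[ (@GRing.inv R).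
  by apply: measurable_fun_inv_gt0 => // x; rewrite /= in_itv/= => /andP[/pos].
rewrite ge0_integral_completed//; last first.
  by move=> x; rewrite /= in_itv/= invr_ge0 => /andP[/pos/ltW].
rewrite integral_itv_bndo_bndc; last exact/measurable_EFinP.
rewrite (@continuous_FTC2 _ (@GRing.inv R) (@ln R))//.
- by apply: within_continuous_inv => x; rewrite /= in_itv/= => /andP[/pos].
- split.
  + move=> x; rewrite in_itv/= => /andP[/ltW/pos x0 _].
    by apply: ex_derive; exact: is_derive1_ln.
  + by apply: cvg_at_right_filter; apply: continuous_ln.
  + by apply: cvg_at_left_filter; apply: continuous_ln; exact: lt_trans ab.
- move=> x; rewrite in_itv/= => /andP[/ltW/pos x0 _].
  by rewrite derive1E; have [_ ->] := is_derive1_ln x0.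
Qed.

Lemma integrable_div_id (R : realType) (f : R -> R) (t : R) :
  cleb.-integrable `]1, t[ (EFin \o f) ->
  cleb.-integrable `]1, t[ (EFin \o (fun x => f x / x)).
Proof.
move=> fi.
have gt1 (x : R) : `]1, t[%classic x -> 1 < x by rewrite /= in_itv/= => /andP[].
have mt : measurable (`]1, t[%classic : set R) by [].
have mi : measurable_fun `]1, t[ (@GRing.inv R).
  by apply: measurable_fun_inv_gt0 => // x /gt1; exact: lt_trans.
have bi : [bounded (@GRing.inv R) x | x in `]1, t[%classic].
  exists 1; split => // M M1 x /gt1 x1; apply: le_trans (ltW M1).
  have x0 : 0 < x by exact: lt_trans x1.
  by rewrite /= ger0_norm ?invr_ge0 ?ltW// invf_lt1.
have cmt := @sub_caratheodory _ _ _ (wlength (@idfun R)) _ mt.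
have product_integrable := @integrableMl _ _ _ cleb _ cmt _ _ fi
  (measurable_fun_completed mt mi) bi.
exact: product_integrable.
Qed.

(** * Logarithmic means of real functions *)

(** The logarithmic mean [(1 / ln t) * \int_1^t f x / x dx] of a real-valued
    function. The real and imaginary parts of the logarithmic mean of a
    complex-valued function are the means of its real and imaginary parts. *)
Definition real_log_mean (R : realType) (f : R -> R) (t : R) : R :=
  (ln t)^-1 * \int[cleb]_(x in `]1, t[) (f x / x).

(** If [f] is within [e] of [c] between two points where its logarithmic mean
    is within [d] of [l], then [c] is close to [l]: both
    [c * (ln x2 - ln x1)] and [l * (ln x2 - ln x1)] approximate the integral
    of [f y / y] from [x1] to [x2]. *)
Lemma real_log_mean_oscillation (R : realType) (f : R -> R)
    (l c e d x1 x2 : R) :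
  1 < x1 -> x1 < x2 ->
  cleb.-integrable `]1, x2[ (EFin \o f) ->
  (forall y, x1 <= y < x2 -> `|f y - c| <= e) ->
  `|real_log_mean f x1 - l| <= d -> `|real_log_mean f x2 - l| <= d ->
  `|c - l| * (ln x2 - ln x1) <= e * (ln x2 - ln x1) + d * (ln x1 + ln x2).
Proof.
move=> x1_gt1 x12 fi osc t1 t2.
have x1_gt0 : 0 < x1 by exact: lt_trans x1_gt1.
have ln1_gt0 : 0 < ln x1 by exact: ln_gt0.
have ln12 : ln x1 < ln x2 by rewrite ltr_ln// posrE (lt_trans x1_gt0).
have ffi := integrable_div_id fi.
have m1 : (wlength (@idfun R))^*%mu.-cara.-measurable `]1, x1[%classic.
  by apply: sub_caratheodory.
have m12 : (wlength (@idfun R))^*%mu.-cara.-measurable `[x1, x2[%classic.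
  by apply: sub_caratheodory.
have sub12 : `[x1, x2[ `<=` `]1, x2[.
  by move=> y; rewrite /= !in_itv/= => /andP[xy ->]; rewrite (lt_le_trans _ xy).
have ffi12 : cleb.-integrable `[x1, x2[ (EFin \o (fun x => f x / x)).
  by apply: integrableS ffi => //; apply: sub_caratheodory.
have pos (y : R) : `[x1, x2[%classic y -> 0 < y.
  by rewrite /= in_itv/= => /andP[+ _]; exact: lt_le_trans.
have ii : cleb.-integrable `[x1, x2[ (EFin \o (@GRing.inv R)).
  apply/integrableP; split.
    apply/measurable_EFinP; apply: measurable_fun_completed => //.
    by apply: measurable_fun_inv_gt0.
  rewrite [ltLHS](_ : _ = (ln x2 - ln x1)%:E) ?ltry//.
  rewrite -integral_inv_ln//; apply: eq_integral => y /set_mem/pos y0.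
  by rewrite /= gtr0_norm// invr_gt0.
set A1 := Rintegral cleb `]1, x1[ (fun x : R => f x / x).
set A2 := Rintegral cleb `]1, x2[ (fun x : R => f x / x).
set J := Rintegral cleb `[x1, x2[ (fun x : R => f x / x).
have A2E : A2 = A1 + J.
  have U : `]1, x1[%classic `|` `[x1, x2[%classic = `]1, x2[%classic :> set R.
    by rewrite -itv_bndbnd_setU// bnd_simp ltW.
  rewrite /A2 -U Rintegral_setU//; first by rewrite U.
  apply/disj_setPS => y; rewrite /= !in_itv/= => -[/andP[_ yx] /andP[xy _]].
  by move: yx; rewrite ltNge xy.
have JcE k :
    Rintegral cleb `[x1, x2[ (fun x : R => k * x^-1) = k * (ln x2 - ln x1).
  rewrite RintegralZl//; congr (_ * _).
  by rewrite /Rintegral integral_inv_ln.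
have kii k : cleb.-integrable `[x1, x2[ (EFin \o (fun x => k * x^-1)).
  by have := integrableZl m12 k ii.
have Jge : (c - e) * (ln x2 - ln x1) <= J.
  rewrite -JcE; apply: le_Rintegral => // y y12.
  rewrite ler_pM2r ?invr_gt0 ?pos//.
  by have := osc y; move: y12; rewrite /= in_itv/= => -> /(_ isT);
    rewrite ler_norml; lra.
have Jle : J <= (c + e) * (ln x2 - ln x1).
  rewrite -JcE; apply: le_Rintegral => // y y12.
  rewrite ler_pM2r ?invr_gt0 ?pos//.
  by have := osc y; move: y12; rewrite /= in_itv/= => -> /(_ isT);
    rewrite ler_norml; lra.
have mean_bound x A : 0 < ln x -> `|(ln x)^-1 * A - l| <= d ->
    `|A - l * ln x| <= d * ln x.
  move=> lx0 Hd.
  rewrite (_ : A - l * ln x = ((ln x)^-1 * A - l) * ln x).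
    by rewrite normrM (gtr0_norm lx0) ler_pM2r.
  by rewrite mulrBl mulrAC mulVf ?mul1r ?gt_eqF.
have := mean_bound _ _ ln1_gt0 t1.
have := mean_bound _ _ (lt_trans ln1_gt0 ln12) t2.
rewrite -/A1 -/A2 A2E => B2 B1.
have ln21 : 0 < ln x2 - ln x1 by rewrite subr_gt0.
rewrite -[X in _ * X <= _](gtr0_norm ln21) -normrM ler_norml.
move: B1 B2 Jge Jle; rewrite !ler_norml.
move=> /andP[b1 b2] /andP[b3 b4] j1 j2.
by apply/andP; split; lra.
Qed.

(** * Slow oscillation and statistical limits far out *)

Lemma slowly_oscillating_near (R : realType) (s : R -> R[i]) (e : R) :
  slowly_oscillating_L1 s -> 0 < e -> exists2 lam, 1 < lam &
    \forall x \near +oo,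
      forall t, x < t <= x `^ lam -> Normc.normc (s t - s x) <= e.
Proof.
move=> so e0.
have /so /= lam_lt : ereal_nbhs 0%E (fun u : \bar R => u < e%:E)%E.
  by apply: open_ereal_lt'; rewrite lte_fin.
have [lam [lam1]] := @filter_ex _ _ _ _
  (filterI (nbhs_right_gt (1 : R)) lam_lt).
move=> /ereal_inf_lt[_ [A Ay <-]] /ltW Ae.
exists lam => //.
apply: filterS Ay => x Ax t xt.
rewrite -lee_fin; apply: le_trans Ae.
apply: (@le_trans _ _ (ereal_sup
       [set (Normc.normc (s t - s x))%:E | t in `]x, x `^ lam]])).
  by apply: ereal_sup_ubound; exists t.
by apply: ereal_sup_ubound; exists x.
Qed.

Lemma statistical_limit_near (R : realType) (g : R -> R[i]) l (d p q : R) :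
  statistical_limit 1 g l -> 0 < d -> 1 <= p -> p < q ->
  \forall x \near +oo,
    exists2 y, x `^ p < y < x `^ q & Normc.normc (g y - l) <= d.
Proof.
move=> sg d0 p1 pq.
have : ereal_nbhs 0%E (fun u : \bar R => u < (2^-1)%:E)%E.
  by apply: open_ereal_lt'; rewrite lte_fin.
move=> /(sg d d0) [M [Mreal Mb]].
have q1 : 1 <= q by rewrite (le_trans p1) ?ltW.
near=> x.
have x1 : 1 < x by near: x; exact: nbhs_pinfty_gt.
have xM : M < x by near: x; exact: nbhs_pinfty_gt.
have x2 : 2 `^ (q - p)^-1 < x by near: x; exact: nbhs_pinfty_gt.
have xp : x <= x `^ p by rewrite le1r_powR // ltW.
have xq : x <= x `^ q by rewrite le1r_powR // ltW.
have x0 : 0 < x by exact: lt_trans x1.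
have x_neq0 : x != 0 by rewrite gt_eqF.
have qp : 2 * x `^ p < x `^ q.
  rewrite -(subrK p q) powRD ?x_neq0 ?implybT// ltr_pM2r ?powR_gt0//.
  rewrite -[ltLHS](@powRr1 R 2) // -(@mulVf _ (q - p)) ?subr_eq0 ?gt_eqF//.
  by rewrite powRrM gt0_ltr_powR ?subr_gt0 ?nnegrE ?powR_ge0 ?ltW.
(* Otherwise the exceptional set would contain the interval from [x `^ p] to
   [x `^ q], whose length is at least [(x `^ q - 1) / 2]. *)
apply: contrapT => noy.
have := Mb (x `^ q) (lt_le_trans xM xq).
apply/negP; rewrite -leNgt.
have b1 : 0 < x `^ q - 1 by rewrite subr_gt0 (lt_le_trans x1).
apply: (@le_trans _ _ ((x `^ q - 1)^-1%:E * (x `^ q - x `^ p)%:E)%E).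
  by rewrite -EFinM lee_fin ler_pdivlMl//; lra.
apply: lee_wpmul2l; first by rewrite lee_fin invr_ge0 ltW.
rewrite (_ : (x `^ q - x `^ p)%:E = cleb `]x `^ p, x `^ q[).
  apply: le_outer_measure => y; rewrite /= in_itv/= => /andP[py yq]; split.
    by rewrite yq andbT (lt_trans _ py)// (lt_le_trans x1).
  rewrite ltNge; apply/negP => gyd; apply: noy; exists y => //.
  by rewrite py yq.
have -> : cleb `]x `^ p, x `^ q[ = lebesgue_measure `]x `^ p, x `^ q[ by [].
have xpq : x `^ p < x `^ q by have := powR_gt0 p x0; lra.
by rewrite lebesgue_measure_itv/= lte_fin xpq EFinB.
Unshelve. all: end_near. Qed.

(** * Real and imaginary parts *)

Lemma ReB (R : rcfType) (z w : R[i]) :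
  complex.Re (z - w) = complex.Re z - complex.Re w.
Proof. by case: z w => [? ?] []. Qed.

Lemma ImB (R : rcfType) (z w : R[i]) :
  complex.Im (z - w) = complex.Im z - complex.Im w.
Proof. by case: z w => [? ?] []. Qed.

Lemma Re_le_normc (R : rcfType) (z : R[i]) : `|complex.Re z| <= Normc.normc z.
Proof.
case: z => a b /=; rewrite -sqrtr_sqr; apply: ler_wsqrtr.
by rewrite lerDl sqr_ge0.
Qed.

Lemma Im_le_normc (R : rcfType) (z : R[i]) : `|complex.Im z| <= Normc.normc z.
Proof.
case: z => a b /=; rewrite -sqrtr_sqr; apply: ler_wsqrtr.
by rewrite lerDr sqr_ge0.
Qed.

Lemma normc_le_ReIm (R : rcfType) (z : R[i]) :
  Normc.normc z <= `|complex.Re z| + `|complex.Im z|.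
Proof.
case: z => a b /=; rewrite -[leRHS]ger0_norm ?addr_ge0//.
rewrite -[leRHS]sqrtr_sqr.
apply: ler_wsqrtr; rewrite sqrrD !real_normK ?num_real//.
by rewrite lerD2r lerDl mulrn_wge0 ?mulr_ge0.
Qed.

Lemma Re_log_mean (R : realType) (s : R -> R[i]) (t : R) :
  complex.Re (log_mean s t) = real_log_mean (fun x => complex.Re (s x)) t.
Proof.
rewrite /log_mean /cintegral -fmorphV /= mul0r subr0; congr (_ * _).
apply: eq_Rintegral => x _.
by rewrite -fmorphV /=; case: (s x) => a b /=; rewrite mulr0 subr0.
Qed.

Lemma Im_log_mean (R : realType) (s : R -> R[i]) (t : R) :
  complex.Im (log_mean s t) = real_log_mean (fun x => complex.Im (s x)) t.
Proof.
rewrite /log_mean /cintegral -fmorphV /= mul0r addr0; congr (_ * _).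
apply: eq_Rintegral => x _.
by rewrite -fmorphV /=; case: (s x) => a b /=; rewrite mulr0 add0r.
Qed.

(** * The Tauberian theorem *)

(** With [L = ln x], [L1 = ln x1] and [L2 = ln x2], the bounds on [L1] and [L2]
    give [L1 + L2 <= 2 * (1 + h) * L] and [L2 - L1 >= h / 3 * L]. *)
Lemma log_gap_bound (R : realFieldType) (h d e L L1 L2 : R) :
  0 < h -> 0 < e -> 0 < d -> 0 < L -> d * (6 * (1 + h)) = e * h ->
  L1 <= (1 + h / 3) * L -> L2 <= (1 + h) * L -> (1 + 2 * h / 3) * L <= L2 ->
  d * (L1 + L2) <= e * (L2 - L1).
Proof.
move=> h0 e0 d0 L0 dE L1le L2le L2ge.
have gap : h * L <= 3 * (L2 - L1) by lra.
have sum : L1 + L2 <= 2 * (1 + h) * L by have := mulr_gt0 h0 L0; lra.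
have : e * (h * L) <= e * (3 * (L2 - L1)) by rewrite ler_pM2l.
have : d * (L1 + L2) <= d * (2 * (1 + h) * L) by rewrite ler_pM2l.
have -> : d * (2 * (1 + h) * L) = d * (6 * (1 + h)) * L / 3 by field.
by rewrite dE; lra.
Qed.

(* R[i]^o is R[i] with the topology given by its modulus. *)
Theorem theorem4 (R : realType) (s : R -> R[i]) (l : R[i])
    (s_integrable : forall t : R, 1 < t -> cintegrable `]1, t[ s)
    (s_slow : slowly_oscillating_L1 s)
    (tau_stat : statistical_limit 1 (log_mean s) l) :
  (s x : R[i]^o) @[x --> +oo] --> (l : R[i]^o).
Proof.
(* A positive element of [R[i]] is a positive real number. *)
apply/cvgrPdist_le => -[E iE]; rewrite ltcE => /andP[/= /eqP -> E0] {iE}.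
(* The real and the imaginary part each contribute at most [2 * e]. *)
pose e := E / 4.
have e0 : 0 < e by rewrite /e; lra.
have [lam lam1 slow] := slowly_oscillating_near s_slow e0.
pose h := lam - 1.
have h0 : 0 < h by rewrite /h subr_gt0.
pose d := e * h / (6 * (1 + h)).
have h6 : 0 < 6 * (1 + h) by lra.
have d0 : 0 < d by apply: divr_gt0 => //; exact: mulr_gt0.
have dE : d * (6 * (1 + h)) = e * h by rewrite /d mulfVK// gt_eqF.
near=> x.
have x_gt1 : 1 < x by near: x; exact: nbhs_pinfty_gt.
have slowx : forall t, x < t <= x `^ lam -> Normc.normc (s t - s x) <= e.
  by near: x.
have [x1 /andP[x1l x1r] t1] : exists2 y, x `^ 1 < y < x `^ (1 + h / 3) &
    Normc.normc (log_mean s y - l) <= d.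
  by near: x; apply: statistical_limit_near => //; lra.
have [x2 /andP[x2l x2r] t2] : exists2 y, x `^ (1 + 2 * h / 3) < y < x `^ lam &
    Normc.normc (log_mean s y - l) <= d.
  by near: x; apply: statistical_limit_near => //; rewrite ?/h; lra.
have x_gt0 : 0 < x by exact: lt_trans x_gt1.
have lnx_gt0 : 0 < ln x by exact: ln_gt0.
have mid : x `^ (1 + h / 3) <= x `^ (1 + 2 * h / 3).
  by apply: ler_powR; [exact: ltW | lra].
rewrite powRr1 ?ltW// in x1l.
have x12 : x1 < x2 by apply: lt_trans x2l; exact: lt_le_trans mid.
have x1_gt1 : 1 < x1 by exact: lt_trans x1l.
have x1_gt0 : 0 < x1 by exact: lt_trans x1_gt1.
have x2_gt0 : 0 < x2 by exact: lt_trans x12.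
have L1 : ln x1 <= (1 + h / 3) * ln x.
  by rewrite -ln_powR ler_ln ?posrE ?powR_gt0// ltW.
have L2 : ln x2 <= (1 + h) * ln x.
  rewrite (_ : 1 + h = lam); last by rewrite /h addrC subrK.
  by rewrite -ln_powR ler_ln ?posrE ?powR_gt0// ltW.
have L3 : (1 + 2 * h / 3) * ln x <= ln x2.
  by rewrite -ln_powR ler_ln ?posrE ?powR_gt0// ltW.
have part_bound (f : R[i] -> R) : (forall z w, f (z - w) = f z - f w) ->
    (forall z, `|f z| <= Normc.normc z) ->
    cleb.-integrable `]1, x2[ (EFin \o (f \o s)) ->
    (forall t, f (log_mean s t) = real_log_mean (f \o s) t) ->
    `|f (s x) - f l| <= 2 * e.
  move=> fB fn fi fm.
  have mean_diff : `|f (s x) - f l| * (ln x2 - ln x1) <=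
      e * (ln x2 - ln x1) + d * (ln x1 + ln x2).
    apply: (real_log_mean_oscillation x1_gt1 x12 fi).
    - move=> y /andP[x1y yx2] /=; rewrite -fB; apply: le_trans (fn _) _.
      by apply: slowx; rewrite (lt_le_trans x1l)//= ltW// (lt_trans yx2).
    - by rewrite -fm -fB; apply: le_trans (fn _) t1.
    - by rewrite -fm -fB; apply: le_trans (fn _) t2.
  have gap : 0 < ln x2 - ln x1 by rewrite subr_gt0 ltr_ln.
  have bound := log_gap_bound h0 e0 d0 lnx_gt0 dE L1 L2 L3.
  by rewrite -(ler_pM2r gap); lra.
have [Re_int Im_int] := s_integrable _ (lt_trans x1_gt1 x12).
have Re_bound : `|complex.Re (s x) - complex.Re l| <= 2 * e.
  by apply: part_bound => //;
    [exact: ReB | exact: Re_le_normc | exact: Re_log_mean].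
have Im_bound : `|complex.Im (s x) - complex.Im l| <= 2 * e.
  by apply: part_bound => //;
    [exact: ImB | exact: Im_le_normc | exact: Im_log_mean].
rewrite distrC.
have -> : `|s x - l| = ((Normc.normc (s x - l))%:C)%C by [].
rewrite -[leRHS]/(E%:C)%C lecR.
apply: le_trans (normc_le_ReIm (s x - l)) _.
by rewrite ReB ImB; move: Re_bound Im_bound; rewrite /e; lra.
Unshelve. all: end_near. Qed.
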